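(* For $h>0$ let $\mathcal{C}_h=\mathbb{S}^1\times I_h$, and let $\lambda_1(\mathcal{C}_h)\le\lambda_2(\mathcal{C}_h)\le\cdots$ be its Dirichlet eigenvalues. Then Pólya's conjecture holds on $\mathcal{C}_h$, that is, $$\lambda_k(\mathcal{C}_h)\ge \frac{2k}{h}\quad\text{for all } k=1,2,3,\dots,$$ if and only if $h$ belongs to $$\left(0,\,8-\sqrt{64-4\pi^2}\right]\cup\left[2+\sqrt{4-\tfrac{\pi^2}{4}},\;13-\sqrt{169-9\pi^2}\right]\cup\left[\tfrac{13}{4}+\sqrt{\tfrac{169}{16}-\pi^2},\;\tfrac{\pi^2}{2}\right].$$ Moreover: (i) for every $h\in\left(8-\sqrt{64-4\pi^2},\,2+\sqrt{4-\frac{\pi^2}{4}}\right)$ the inequality $\lambda_k(\mathcal{C}_h)\ge 2k/h$ fails for $k=8$ and for no other $k$; (ii) for every $h\in\left(13-\sqrt{169-9\pi^2},\,\frac{13}{4}+\sqrt{\frac{169}{16}-\pi^2}\right)$ the inequality $\lambda_k(\mathcal{C}_h)\ge 2k/h$ fails for $k=13$ and for no other $k$; (iii) for every $h>\pi^2/2$ the inequality $\lambda_k(\mathcal{C}_h)\ge 2k/h$ fails for $k=1$, and for some larger values of $h$ it also fails for some $k\ge 2$.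
   Context: $\mathbb{S}^1$ is the unit circle (of length $2\pi$), $I_h$ is an open interval of length $h>0$, and $\mathcal{C}_h=\mathbb{S}^1\times I_h$ is the flat cylindrical strip with the product metric, of area $|\mathcal{C}_h|=2\pi h$. Its Dirichlet eigenvalues are the eigenvalues of $-\Delta$ (minus the Laplace–Beltrami operator) on $\mathcal{C}_h$ with Dirichlet conditions on the two boundary circles. Explicitly, they are the numbers $m^2+n^2\pi^2/h^2$ with $(m,n)\in\mathbb{Z}\times\mathbb{N}$, $\mathbb{N}=\{1,2,\dots\}$, one for each pair $(m,n)$ (so counted with multiplicity), listed in non-decreasing order as $\lambda_1(\mathcal{C}_h)\le\lambda_2(\mathcal{C}_h)\le\cdots$. Pólya's conjecture for a two-dimensional domain $\Omega$ is the statement $\lambda_k(\Omega)\ge 4\pi k/|\Omega|$ for all $k\geq 1$, which for $\mathcal{C}_h$ reads $\lambda_k(\mathcal{C}_h)\ge 2k/h$. *)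

(* Defs.v *)
From Stdlib Require Import Reals ZArith.
Open Scope R_scope.

(* Dirichlet eigenvalue of S^1 x (0, h), S^1 of length 2 PI, attached to the
   mode (m, n), with eigenfunction exp(i m x) sin(n PI y / h).  Opposite
   frequencies m and - m are different modes, and modes need n >= 1. *)
Definition mode_eigenvalue (h : R) (p : Z * nat) : R :=
  IZR (fst p) ^ 2 + INR (snd p) ^ 2 * PI ^ 2 / h ^ 2.

(* [lambda 1 <= lambda 2 <= ...] lists the Dirichlet eigenvalues of S^1 x (0, h),
   each mode being counted exactly once (through [mode], a bijection from
   {1, 2, ...} to Z x {1, 2, ...}).  The value [lambda 0] is irrelevant. *)
Definition dirichlet_spectrum (h : R) (lambda : nat -> R) : Prop :=
  (forall j k : nat, (1 <= j <= k)%nat -> lambda j <= lambda k) /\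
  exists mode : nat -> Z * nat,
    (forall k : nat, (1 <= k)%nat ->
       (1 <= snd (mode k))%nat /\ lambda k = mode_eigenvalue h (mode k)) /\
    (forall p : Z * nat, (1 <= snd p)%nat ->
       exists! k : nat, (1 <= k)%nat /\ mode k = p).

(* The inequality lambda_k >= 4 PI k / area, the area being 2 PI h. *)
Definition polya_inequality (h : R) (lambda : nat -> R) (k : nat) : Prop :=
  lambda k >= 2 * INR k / h.

(* Main.v *)
Require Import Defs.
From Stdlib Require Import Reals ZArith Lra Lia List Machin.
Open Scope R_scope.

(* Put b = PI / h and a = 1 / b.  The inequality for k says that fewer than k modes
   satisfy m^2 + b^2 n^2 < r^2, where r^2 = 2 k b / PI, and k is then exactly the area of
   the half ellipse { m^2 + b^2 y^2 < r^2, y > 0 }.  The number of lattice points is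
   compared with the area in three regimes, for 2 / PI <= b, that is h <= PI^2 / 2.

   - If 2 <= b, the row lengths are summed by the trapezoid rule, which for the arc of a
     circle amounts to sin x <= x.  The half row at height 0 is the gain.
   - If b <= 2 and 18 <= r, the columns are cut at the point of slope -1.  On the steep
     side the trapezoid rule is used column by column.  On the flat side it is used once
     for each level of the integer part of the height, which gains 1/2 per column.  With
     a top of height a r, the total gain is r (sqrt (1 + a^2) - a), up to O(sqrt r) at the
     two ends of the arc.
   - If b <= 2 and r < 18, the count is monotone in b and k, and the remaining (b, k) are
     divided into rectangles treated by computation, except where the inequality is sharp:
     (b = 2 / PI, k = 1 and 4), k = 8 and k = 13, where explicit modes decide. *)

(** * Pigeonhole arguments on the spectrum *)

(** Were [lam k] below the bound, the modes of indices 1 to [k] would be [k] distinct elements of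
    the shorter list [L]. *)
Lemma spectrum_cover (h : R) (lam : nat -> R) (k : nat) (L : list (Z * nat)) :
  dirichlet_spectrum h lam ->
  (forall p, (1 <= snd p)%nat -> mode_eigenvalue h p < 2 * INR k / h -> In p L) ->
  (length L < k)%nat -> polya_inequality h lam k.
Proof.
intros [Hmono [mode [Hmode Huniq]]] HL Hk.
unfold polya_inequality.
destruct (Rlt_or_le (lam k) (2 * INR k / h)) as [Hlt | Hle]; [exfalso | lra].
assert (Hnd : NoDup (map mode (seq 1 k))).
{ apply NoDup_map_NoDup_ForallPairs; [ | apply seq_NoDup].
  intros i j Hi Hj Hij. apply in_seq in Hi, Hj.
  destruct (Huniq (mode i)) as [l [_ Hl]]; [apply Hmode; lia | ].
  rewrite <- (Hl i), <- (Hl j); auto; split; auto; lia. }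
assert (Hincl : incl (map mode (seq 1 k)) L).
{ intros p Hp. apply in_map_iff in Hp. destruct Hp as [j [<- Hj]].
  apply in_seq in Hj. destruct (Hmode j) as [H1 H2]; [lia | ].
  apply HL; auto. rewrite <- H2.
  apply Rle_lt_trans with (lam k); auto. apply Hmono; lia. }
pose proof (NoDup_incl_length Hnd Hincl) as Hlen.
rewrite length_map, length_seq in Hlen. lia.
Qed.

(** If [lam (length L)] reached the bound, the modes of [L] would all have indices between 1 and
    [length L - 1], too few for a list without repetition. *)
Lemma spectrum_violation (h : R) (lam : nat -> R) (L : list (Z * nat)) :
  dirichlet_spectrum h lam -> L <> nil -> NoDup L ->
  (forall p, In p L ->
     (1 <= snd p)%nat /\ mode_eigenvalue h p < 2 * INR (length L) / h) ->
  ~ polya_inequality h lam (length L).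
Proof.
intros [Hmono [mode [Hmode Huniq]]] Hnil Hnd HL Hpol.
unfold polya_inequality in Hpol.
assert (Hincl : incl L (map mode (seq 1 (length L - 1)))).
{ intros p Hp. destruct (HL p Hp) as [H1 H2].
  destruct (Huniq p H1) as [j [[Hj Hjp] _]].
  apply in_map_iff. exists j; split; auto. apply in_seq.
  destruct (Hmode j Hj) as [_ Hl]. rewrite Hjp in Hl.
  destruct (Nat.le_gt_cases (length L) j) as [Hc | Hc]; [ | lia].
  exfalso. assert (1 <= length L)%nat by (destruct L; simpl; [easy | lia]).
  pose proof (Hmono (length L) j ltac:(lia)). lra. }
pose proof (NoDup_incl_length Hnd Hincl) as Hlen.
rewrite length_map, length_seq in Hlen.
destruct L; [easy | simpl in Hlen; lia].
Qed.

(* With [b = PI / h], says that the eigenvalue of the mode [(m, n)] is below [2 k / h]. *)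
Definition below (b : R) (k : nat) (m : Z) (n : nat) : Prop :=
  PI * (IZR m ^ 2 + INR n ^ 2 * b ^ 2) < 2 * INR k * b.

Definition few_below (b : R) (k : nat) : Prop :=
  exists L : list (Z * nat), (length L < k)%nat /\
    forall m n, (1 <= n)%nat -> below b k m n -> In (m, n) L.

Lemma eigenvalue_below (h : R) (k : nat) (p : Z * nat) : 0 < h ->
  mode_eigenvalue h p < 2 * INR k / h <-> below (PI / h) k (fst p) (snd p).
Proof.
intros Hh. unfold below, mode_eigenvalue. pose proof PI_RGT_0 as Hpi.
replace (2 * INR k * (PI / h)) with (PI * (2 * INR k / h)) by (field; lra).
replace ((PI / h) ^ 2) with (PI ^ 2 / h ^ 2) by (field; lra).
replace (INR (snd p) ^ 2 * PI ^ 2 / h ^ 2)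
  with (INR (snd p) ^ 2 * (PI ^ 2 / h ^ 2)) by (field; lra).
split; intros H.
- now apply Rmult_lt_compat_l.
- now apply Rmult_lt_reg_l in H.
Qed.

Lemma few_below_polya (h : R) (lam : nat -> R) (k : nat) : 0 < h ->
  dirichlet_spectrum h lam -> few_below (PI / h) k -> polya_inequality h lam k.
Proof.
intros Hh Hs [L [Hlen HL]]. apply spectrum_cover with L; auto.
intros [m n] Hn Hp. apply HL; auto. now apply eigenvalue_below in Hp.
Qed.

Lemma PI_bounds : 333 / 106 < PI < 355 / 113.
Proof.
(* Alternating partial sums of the series of [PI / 4 = 2 atan (1 / 3) + atan (1 / 7)]. *)
pose proof (PI_2_3_7_ineq 3) as H.
unfold tg_alt, PI_2_3_7_tg, Ratan_seq in H. cbn [sum_f_R0 Nat.mul Nat.add] in H.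
simpl in H. lra.
Qed.

(** * Lattice points in symmetric rows and columns *)

Definition zrange (q : nat) : list Z :=
  map (fun i => (Z.of_nat i - Z.of_nat q)%Z) (seq 0 (2 * q + 1)).

Lemma in_zrange (q : nat) (z : Z) : (Z.abs z <= Z.of_nat q)%Z -> In z (zrange q).
Proof.
intros H. apply in_map_iff. exists (Z.to_nat (z + Z.of_nat q)).
rewrite in_seq. lia.
Qed.

(** The index starts at 1 because rows have [n >= 1], and column 0, having no mirror image, is
    counted apart. *)
Fixpoint rsum (f : nat -> R) (n : nat) : R :=
  match n with O => 0 | S i => rsum f i + f (S i) end.

Lemma rsum_le (f g : nat -> R) (n : nat) :
  (forall i, (1 <= i <= n)%nat -> f i <= g i) -> rsum f n <= rsum g n.
Proof.
intros H. induction n as [|n IH]; simpl; [lra | ].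
assert (f (S n) <= g (S n)) by (apply H; lia).
assert (rsum f n <= rsum g n) by (apply IH; intros; apply H; lia). lra.
Qed.

Lemma rsum_affine (u v : R) (f : nat -> R) (n : nat) :
  rsum (fun i => u * f i + v) n = u * rsum f n + v * INR n.
Proof.
induction n as [|n IH]; [simpl; ring | ].
rewrite S_INR. simpl. rewrite IH. ring.
Qed.

Lemma length_flat_map_seq {A : Type} (f : nat -> list A) (n : nat) :
  INR (length (flat_map f (seq 1 n))) = rsum (fun i => INR (length (f i))) n.
Proof.
induction n as [|n IH]; [reflexivity | ].
rewrite seq_S, flat_map_app, length_app, plus_INR, IH. simpl.
now rewrite app_nil_r.
Qed.

Lemma few_below_rows (b : R) (k : nat) (q : nat -> nat) (M : nat) :
  (forall m n, (1 <= n)%nat -> below b k m n ->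
     (n <= M)%nat /\ (Z.abs m <= Z.of_nat (q n))%Z) ->
  rsum (fun n => 2 * INR (q n) + 1) M < INR k -> few_below b k.
Proof.
intros H Hlen.
exists (flat_map (fun n => map (fun m => (m, n)) (zrange (q n))) (seq 1 M)).
split.
- apply INR_lt. rewrite length_flat_map_seq.
  eapply Rle_lt_trans; [ | exact Hlen]. apply rsum_le. intros i _.
  unfold zrange. rewrite !length_map, length_seq, plus_INR, mult_INR. simpl. lra.
- intros m n Hn Hb. destruct (H m n Hn Hb) as [H1 H2].
  apply in_flat_map. exists n. rewrite in_seq. split; [lia | ].
  apply in_map_iff. exists m. split; auto. now apply in_zrange.
Qed.

Lemma few_below_columns (b : R) (k : nat) (G : nat -> nat) (Q : nat) :
  (forall m n, (1 <= n)%nat -> below b k m n ->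
     (Z.abs_nat m <= Q)%nat /\ (n <= G (Z.abs_nat m))%nat) ->
  INR (G O) + 2 * rsum (fun m => INR (G m)) Q < INR k -> few_below b k.
Proof.
intros H Hlen.
set (col := fun m => map (pair m) (seq 1 (G (Z.abs_nat m)))).
exists (col 0%Z ++ flat_map (fun m => col (Z.of_nat m) ++ col (- Z.of_nat m)%Z) (seq 1 Q)).
assert (Hcol : forall m, length (col m) = G (Z.abs_nat m)).
{ intros m. unfold col. now rewrite length_map, length_seq. }
split.
- apply INR_lt. rewrite length_app, plus_INR, length_flat_map_seq, Hcol.
  replace (rsum _ Q) with (2 * rsum (fun m => INR (G m)) Q); [exact Hlen | ].
  clear Hlen H. induction Q as [|Q IH]; [simpl; ring | ].
  cbn [rsum]. rewrite Rmult_plus_distr_l, IH, length_app, plus_INR, !Hcol.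
  replace (Z.abs_nat (- Z.of_nat (S Q))) with (S Q) by lia.
  rewrite Zabs2Nat.id. ring.
- intros m n Hn Hb. destruct (H m n Hn Hb) as [H1 H2].
  assert (Hin : In (m, n) (col m)).
  { apply in_map_iff. exists n. rewrite in_seq. split; auto; lia. }
  apply in_or_app. destruct (Z.eq_dec m 0) as [-> | Hm]; [now left | right].
  apply in_flat_map. exists (Z.abs_nat m). rewrite in_seq. split; [lia | ].
  apply in_or_app. rewrite Nat2Z.inj_abs_nat.
  destruct (Z.abs_eq_or_opp m) as [E | E]; rewrite E; [now left | right].
  now rewrite Z.opp_involutive.
Qed.


(** * Certified counting on rectangles *)

Open Scope Z_scope.

(* Counts the lattice points [(x, y)], [y >= 1], with [c x^2 + d y^2 < t] by walking
   along the boundary from the top row: at position [(m, n)], [v], [dx] and [dy] are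
   [c m^2 + d n^2 - t] and its forward and backward increments in [m] and [n]. *)
Fixpoint stair (fuel : nat) (c d v dx dy n : Z) (axis : bool) : option Z :=
  match fuel with
  | O => None
  | S f =>
    if n <=? 0 then Some 0 else
    if v <? 0 then
      option_map (Z.add (if axis then n else 2 * n))
        (stair f c d (v + dx) (dx + 2 * c) dy n false)
    else stair f c d (v - dy) dx (dy - 2 * d) (n - 1) axis
  end.

(** Invariant of the walk: no column with [m <= |x|] rises above [n], and [L] has to cover only
    those columns. A point inside the ellipse charges [n] to each of the columns [m] and [- m] and
    moves right; a point outside lowers the height. *)
Lemma stair_cover (c d t : Z) (fuel : nat) : forall m n s, 0 <= m ->
  stair fuel c d (c * m ^ 2 + d * n ^ 2 - t) (c * (2 * m + 1)) (d * (2 * n - 1)) n (m =? 0)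
    = Some s ->
  0 <= c -> (forall y, 0 <= y -> c * m ^ 2 + d * y ^ 2 < t -> y <= n) ->
  exists L : list (Z * nat), Z.of_nat (length L) <= s /\ forall x y, m <= Z.abs x -> (1 <= y)%nat ->
      c * x ^ 2 + d * Z.of_nat y ^ 2 < t -> In (x, y) L.
Proof.
induction fuel as [|f IH]; intros m n s Hm Hs Hc Hn; [discriminate | ].
assert (Hmono : forall x, m <= Z.abs x -> c * m ^ 2 <= c * x ^ 2).
{ intros x Hx. apply Z.mul_le_mono_nonneg_l; auto.
  rewrite (Z.pow_even_abs x 2) by now exists 1. apply Z.pow_le_mono_l; lia. }
cbn [stair] in Hs. destruct (Z.leb_spec n 0) as [Hn0 | Hn0].
- injection Hs as <-. exists nil. split; [easy | ].
  intros x y Hx Hy Hxy. specialize (Hmono x Hx). specialize (Hn (Z.of_nat y)). lia.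
- destruct (Z.ltb_spec (c * m ^ 2 + d * n ^ 2 - t) 0) as [Hv | Hv].
  + replace (c * m ^ 2 + d * n ^ 2 - t + c * (2 * m + 1))
      with (c * (m + 1) ^ 2 + d * n ^ 2 - t) in Hs by ring.
    replace (c * (2 * m + 1) + 2 * c) with (c * (2 * (m + 1) + 1)) in Hs by ring.
    replace false with (m + 1 =? 0) in Hs by (apply Z.eqb_neq; lia).
    destruct (stair f _ _ _ _ _ _ _) as [s' | ] eqn:Es; [ | discriminate].
    cbn [option_map] in Hs.
    assert (Hss : s = (if m =? 0 then n else 2 * n) + s') by congruence.
    subst s.
    destruct (IH (m + 1) n s') as [L [HL1 HL2]]; auto; try lia.
    { intros y Hy Hyt. apply Hn; auto. specialize (Hmono (m + 1)). lia. }
    set (col := fun x : Z => map (pair x) (seq 1 (Z.to_nat n))).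
    assert (Hcol : forall x, length (col x) = Z.to_nat n).
    { intros x. unfold col. now rewrite length_map, length_seq. }
    exists ((col m ++ if m =? 0 then nil else col (- m)) ++ L). split.
    { rewrite !length_app, Hcol. destruct (m =? 0); rewrite ?Hcol; cbn [length]; lia. }
    intros x y Hx Hy Hxy. apply in_or_app.
    destruct (Z.eq_dec (Z.abs x) m) as [Hxm | Hxm]; [left | right; apply HL2; auto; lia].
    assert (Hin : In (x, y) (col x)).
    { apply in_map_iff. exists y. rewrite in_seq. split; auto.
      specialize (Hmono x Hx). specialize (Hn (Z.of_nat y)). lia. }
    apply in_or_app. destruct (Z.eq_dec x m) as [E | E].
    { left. now rewrite <- E. }
    right. destruct (Z.eqb_spec m 0); [lia | ]. now replace (- m) with x by lia.
  + replace (c * m ^ 2 + d * n ^ 2 - t - d * (2 * n - 1))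
      with (c * m ^ 2 + d * (n - 1) ^ 2 - t) in Hs by ring.
    replace (d * (2 * n - 1) - 2 * d) with (d * (2 * (n - 1) - 1)) in Hs by ring.
    apply (IH m (n - 1) s); auto.
    intros y Hy Hyt. specialize (Hn y Hy Hyt).
    destruct (Z.eq_dec y n) as [-> | ]; lia.
Qed.

(* For [i / 1000 <= b <= j / 1000] and [k <= k2], a mode [(x, y)] that counts satisfies
   [x^2 / (j / 1000) + y^2 (i / 1000) < 2 k2 106 / 333], as [/ PI < 106 / 333]. *)
Definition box_count (k1 k2 i j : Z) : bool :=
  let c := 333 * 1000 * 1000 in
  let d := 333 * i * j in
  let t := 2 * k2 * 106 * j * 1000 in
  let n := Z.sqrt (t / d) in
  match stair 200 c d (d * n ^ 2 - t) c (d * (2 * n - 1)) n true with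
  | Some s => s <? k1
  | None => false
  end.

Lemma box_count_few_below (k1 k2 i j : Z) (b : R) (k : nat) :
  box_count k1 k2 i j = true -> 0 < i ->
  (IZR i / 1000 <= b <= IZR j / 1000)%R -> k1 <= Z.of_nat k <= k2 -> few_below b k.
Proof.
unfold box_count. intros Hbox Hi Hb Hk.
set (c := 333 * 1000 * 1000) in *. set (d := 333 * i * j) in *.
set (t := 2 * k2 * 106 * j * 1000) in *. set (n := Z.sqrt (t / d)) in *.
destruct (stair _ _ _ _ _ _ _ _) as [s | ] eqn:Es; [ | discriminate].
apply Z.ltb_lt in Hbox.
assert (Hij : i <= j) by (apply le_IZR; lra).
assert (Hd : 0 < d) by (unfold d; nia).
destruct (stair_cover c d t 200 0 n s) as [L [HL1 HL2]]; try lia.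
- rewrite <- Es. f_equal; ring.
- intros y Hy Hyt. apply Z.sqrt_le_square; [apply Z.div_pos; lia | lia | ].
  apply Z.div_le_lower_bound; nia.
- exists L. split; [lia | ]. intros x y Hy Hxy.
  apply HL2; [lia | auto | ]. apply lt_IZR.
  assert (Hsq : forall z : Z, IZR (z ^ 2) = (IZR z ^ 2)%R)
    by (intros z; rewrite Z.pow_2_r, mult_IZR; ring).
  unfold c, d, t. rewrite plus_IZR, !mult_IZR, !Hsq, <- INR_IZR_INZ.
  unfold below in Hxy. pose proof PI_bounds as [Hpi _].
  set (X := (IZR x ^ 2)%R) in *. set (Y := (INR y ^ 2)%R) in *.
  assert (0 <= X)%R by (unfold X; nra). assert (0 <= Y)%R by (unfold Y; nra).
  assert (Hik : (INR k <= IZR k2)%R) by (rewrite INR_IZR_INZ; apply IZR_le; lia).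
  assert (Hi0 : (1 <= IZR i)%R) by (apply IZR_le; lia).
  assert (Hk0 : (0 <= INR k)%R) by apply pos_INR.
  assert (Hb0 : (0 < b)%R) by lra.
  assert (H1 : (333 * (X + Y * b ^ 2) < 106 * (2 * IZR k2 * b))%R).
  { assert (0 <= X + Y * b ^ 2)%R by nra.
    assert (333 / 106 * (X + Y * b ^ 2) <= PI * (X + Y * b ^ 2))%R
      by (apply Rmult_le_compat_r; lra).
    assert (INR k * b <= IZR k2 * b)%R by (apply Rmult_le_compat_r; lra).
    lra. }
  set (J := (IZR j / 1000)%R) in *. set (I := (IZR i / 1000)%R) in *.
  replace (IZR j) with (1000 * J)%R by (unfold J; field).
  replace (IZR i) with (1000 * I)%R by (unfold I; field).
  (* After multiplication by [J / b >= 1], the coefficient of [X] is at least 1 and that of [Y],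
     [b J], is at least [I J], while the right side no longer depends on [b]. *)
  assert (Hratio : (1 <= J / b)%R)
    by (apply Rmult_le_reg_r with b; [lra | field_simplify; lra]).
  assert (H2 : (333 * (X + Y * b ^ 2) * (J / b) < 106 * (2 * IZR k2 * b) * (J / b))%R)
    by (apply Rmult_lt_compat_r; lra).
  replace (106 * (2 * IZR k2 * b) * (J / b))%R with (106 * (2 * IZR k2 * J))%R in H2
    by (field; lra).
  replace (333 * (X + Y * b ^ 2) * (J / b))%R
    with (333 * (X * (J / b) + Y * (b * J)))%R in H2 by (field; lra).
  assert (X * 1 <= X * (J / b))%R by (apply Rmult_le_compat_l; lra).
  assert (I * J <= b * J)%R by (apply Rmult_le_compat_r; lra).
  assert (Y * (I * J) <= Y * (b * J))%R by (apply Rmult_le_compat_l; lra).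
  lra.
Qed.

(* The first test discards the rectangles on which [r^2 = 2 k b / PI] is at least [18^2]. *)
Fixpoint boxes (fuel : nat) (k1 k2 i j : Z) : bool :=
  match fuel with
  | O => false
  | S f =>
    if 324 * 355 * 1000 <=? 2 * k1 * i * 113 then true else
    if box_count k1 k2 i j then true else
    if (j - i) * k1 <? 2 * (k2 - k1) * i then
      let l := (k1 + k2) / 2 in
      boxes f k1 l i j && boxes f (l + 1) k2 i j
    else
      let l := (i + j) / 2 in
      boxes f k1 k2 i l && boxes f k1 k2 l j
  end.

(** A discarded rectangle contains no pair with [2 k b < 324 PI], since [PI < 355 / 113]; any other
    is either certified or split into two that cover it. *)
Lemma boxes_few_below (fuel : nat) : forall (k1 k2 i j : Z) (b : R) (k : nat),
  boxes fuel k1 k2 i j = true -> 0 < i -> 0 <= k1 ->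
  (IZR i / 1000 <= b <= IZR j / 1000)%R -> k1 <= Z.of_nat k <= k2 ->
  (2 * INR k * b < 324 * PI)%R -> few_below b k.
Proof.
induction fuel as [|f IH]; intros k1 k2 i j b k Hbox Hi Hk1 Hb Hk Hlt; [discriminate | ].
cbn [boxes] in Hbox.
destruct (Z.leb_spec (324 * 355 * 1000) (2 * k1 * i * 113)) as [Hle | _].
{ exfalso. apply IZR_le in Hle. rewrite !mult_IZR in Hle.
  pose proof PI_bounds as [_ Hpi].
  assert (IZR k1 <= INR k)%R by (rewrite INR_IZR_INZ; apply IZR_le; lia).
  apply IZR_le in Hk1. apply IZR_lt in Hi.
  assert (IZR k1 * (IZR i / 1000) <= INR k * b)%R by (apply Rmult_le_compat; lra).
  lra. }
destruct (box_count k1 k2 i j) eqn:Ec.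
{ now apply box_count_few_below with k1 k2 i j. }
(* The ellipse of a rectangle has area about [k2 sqrt (j / i)], so a relative width in [b] costs
   half as much as one in [k]; the costlier side is halved. *)
destruct (_ <? _).
- apply andb_prop in Hbox. destruct Hbox as [Hl Hr].
  destruct (Z.le_gt_cases (Z.of_nat k) ((k1 + k2) / 2)).
  + apply (IH k1 ((k1 + k2) / 2) i j); auto; lia.
  + apply (IH ((k1 + k2) / 2 + 1) k2 i j); auto; [ | lia].
    pose proof (Z.div_pos (k1 + k2) 2). lia.
- apply andb_prop in Hbox. destruct Hbox as [Hl Hr].
  assert (Hij : i <= j) by (apply le_IZR; lra).
  destruct (Rle_or_lt b (IZR ((i + j) / 2) / 1000)).
  + apply (IH k1 k2 i ((i + j) / 2)); auto; lra.
  + apply (IH k1 k2 ((i + j) / 2) j); auto; [ | lra].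
    apply Z.lt_le_trans with i; [lia | apply Z.div_le_lower_bound; lia].
Qed.

Close Scope Z_scope.

(** * Area under an arc of a circle *)

Lemma sin_le_id (x : R) : 0 <= x -> sin x <= x.
Proof.
intros [H | <-]; [left; now apply sin_lt_x | rewrite sin_0; lra].
Qed.

(* The derivative of the difference is [2 (1 - cos x)^2]. *)
Lemma sin_cos_cap (x : R) : 0 <= x -> 4 * sin x - sin x * cos x <= 3 * x.
Proof.
intros [H | <-]; [ | rewrite sin_0; lra].
set (f := fun x => 3 * x - 4 * sin x + sin x * cos x).
destruct (MVT_cor2 f (fun x => 3 - 4 * cos x + (cos x * cos x + sin x * - sin x)) 0 x H)
  as [c [Hc _]].
- intros c _. unfold f. apply derivable_pt_lim_plus.
  + apply derivable_pt_lim_minus.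
    * replace 3 with (3 * 1) at 2 by ring. apply derivable_pt_lim_scal, derivable_pt_lim_id.
    * apply derivable_pt_lim_scal, derivable_pt_lim_sin.
  + apply derivable_pt_lim_mult; [apply derivable_pt_lim_sin | apply derivable_pt_lim_cos].
- unfold f in Hc. rewrite sin_0 in Hc. pose proof (sin2_cos2 c) as H1. unfold Rsqr in H1.
  assert (0 <= (1 - cos c) ^ 2) by apply pow2_ge_0. nra.
Qed.

Definition arc (r x : R) : R := sqrt (r ^ 2 - x ^ 2).

(* The area under the arc between the abscissae [0] and [x]. *)
Definition area (r x : R) : R := (x * arc r x + r ^ 2 * asin (x / r)) / 2.

Lemma arc_ge_0 (r x : R) : 0 <= arc r x.
Proof. apply sqrt_pos. Qed.

Lemma arc_sqr (r x : R) : 0 <= x <= r -> arc r x ^ 2 = r ^ 2 - x ^ 2.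
Proof. intros H. unfold arc. rewrite pow2_sqrt; nra. Qed.

Lemma arc_decr (r x y : R) : 0 <= x <= y -> arc r y <= arc r x.
Proof. intros H. unfold arc. apply sqrt_le_1_alt. nra. Qed.

Lemma arc_0 (r : R) : 0 <= r -> arc r 0 = r.
Proof.
intros H. unfold arc. replace (r ^ 2 - 0 ^ 2) with (r ^ 2) by ring. now apply sqrt_pow2.
Qed.

(** With the angle measured from the vertical axis, area estimates become inequalities between a
    sine and its angle. *)
Lemma arc_angle (r x : R) : 0 < r -> 0 <= x <= r -> exists phi, 0 <= phi <= PI / 2 /\
  x = r * sin phi /\ arc r x = r * cos phi /\
  area r x = r ^ 2 * (sin phi * cos phi + phi) / 2.
Proof.
intros Hr Hx.
assert (Hxr : 0 <= x / r <= 1).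
{ split; [apply Rmult_le_pos; [lra | left; apply Rinv_0_lt_compat; lra] | ].
  apply Rmult_le_reg_r with r; [lra | field_simplify; lra]. }
assert (H1 : sin (asin (x / r)) = x / r) by (apply sin_asin; lra).
assert (H2 : arc r x = r * cos (asin (x / r))).
{ rewrite cos_asin by lra. unfold arc.
  replace (r ^ 2 - x ^ 2) with (r ^ 2 * (1 - (x / r)²)) by (unfold Rsqr; field; lra).
  rewrite sqrt_mult_alt, sqrt_pow2; nra. }
exists (asin (x / r)). pose proof (asin_bound (x / r)) as Hb.
split; [ | split; [ | split]].
- split; [ | lra]. destruct (Rle_or_lt 0 (asin (x / r))) as [ | Hneg]; [lra | ].
  pose proof (sin_lt_0_var (asin (x / r))). pose proof PI_RGT_0. lra.
- rewrite H1. field. lra.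
- exact H2.
- unfold area. rewrite H2, H1. field. lra.
Qed.

Lemma area_0 (r : R) : area r 0 = 0.
Proof. unfold area. replace (0 / r) with 0 by (unfold Rdiv; ring). rewrite asin_0. lra. Qed.

Lemma area_r (r : R) : 0 < r -> area r r = PI * r ^ 2 / 4.
Proof.
intros H. unfold area, arc. replace (r / r) with 1 by (field; lra).
rewrite asin_1, Rminus_diag, sqrt_0. field.
Qed.

(** In angles [p <= q], the area exceeds the trapezoid by [r^2 (q - p - sin (q - p)) / 2]. *)
Lemma area_trapezoid (r x y : R) : 0 < r -> 0 <= x <= y -> y <= r ->
  (y - x) * (arc r x + arc r y) / 2 <= area r y - area r x.
Proof.
intros Hr Hx Hy.
destruct (arc_angle r x) as [p [Hp [Ex [Ax Fx]]]]; [lra | lra | ].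
destruct (arc_angle r y) as [q [Hq [Ey [Ay Fy]]]]; [lra | lra | ].
assert (Hpq : p <= q).
{ destruct (Rle_or_lt p q) as [ | Hlt]; [lra | ].
  pose proof (sin_increasing_1 q p). assert (sin p <= sin q); [ | lra].
  apply Rmult_le_reg_l with r; lra. }
pose proof (sin_le_id (q - p) ltac:(lra)) as Hs. rewrite sin_minus in Hs.
rewrite Fx, Fy, Ax, Ay, Ex, Ey.
assert (0 <= r ^ 2) by apply pow2_ge_0. nra.
Qed.

(** The cap above the chord fills at least 2/3 of its enclosing rectangle, the ratio of a parabolic
    segment. *)
Lemma area_top_cap (r x : R) : 0 < r -> 0 <= x <= r ->
  x * arc r x + 2 / 3 * x * (r - arc r x) <= area r x.
Proof.
intros Hr Hx. destruct (arc_angle r x) as [p [Hp [Ex [Ax Fx]]]]; [lra | lra | ].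
pose proof (sin_cos_cap p ltac:(lra)) as Hs. rewrite Fx, Ax, Ex.
assert (0 <= r ^ 2) by apply pow2_ge_0. nra.
Qed.

(** The top cap after a quarter turn, hence the angle [PI / 2 - p]. *)
Lemma area_side_cap (r x : R) : 0 < r -> 0 <= x <= r ->
  2 / 3 * (r - x) * arc r x <= area r r - area r x.
Proof.
intros Hr Hx. destruct (arc_angle r x) as [p [Hp [Ex [Ax Fx]]]]; [lra | lra | ].
pose proof (sin_cos_cap (PI / 2 - p) ltac:(lra)) as Hs.
rewrite cos_shift, sin_shift in Hs.
rewrite area_r, Fx, Ax, Ex by lra. assert (0 <= r ^ 2) by apply pow2_ge_0. nra.
Qed.

(** Trapezoids over unit intervals: the end ordinates count by half, which leaves the correction
    term. *)
Lemma area_steep (r : R) (p Q : nat) : 0 < r -> (p <= Q)%nat -> INR Q <= r ->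
  rsum (fun m => arc r (INR m)) Q - rsum (fun m => arc r (INR m)) p
    + (arc r (INR p) - arc r (INR Q)) / 2 <= area r (INR Q) - area r (INR p).
Proof.
intros Hr HpQ. induction HpQ as [|Q HpQ IH]; intros HQ; [lra | ].
rewrite S_INR in HQ. specialize (IH ltac:(lra)). cbn [rsum].
pose proof (pos_INR Q) as HQ0.
pose proof (area_trapezoid r (INR Q) (INR (S Q))) as Ht.
rewrite S_INR in *. specialize (Ht Hr ltac:(lra) ltac:(lra)). lra.
Qed.

(** The level of [G] through [p] starts just after [p']; a single trapezoid will span it from [p']
    to [p]. *)
Lemma last_higher (G : nat -> nat) (p : nat) :
  (forall m n, (m <= n)%nat -> (G n <= G m)%nat) -> (G p < G O)%nat ->
  exists p', (p' < p)%nat /\ (G p < G p')%nat /\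
    forall m, (p' < m <= p)%nat -> G m = G p.
Proof.
intros HG. induction p as [|p IH]; intros Hp; [lia | ].
destruct (Nat.eq_dec (G p) (G (S p))) as [E | E].
- rewrite <- E in *. destruct (IH Hp) as [p' [H1 [H2 H3]]].
  exists p'. repeat split; auto; try lia. intros m Hm.
  destruct (Nat.eq_dec m (S p)) as [-> | ]; [lia | apply H3; lia].
- exists p. pose proof (HG p (S p)). repeat split; try lia.
  intros m Hm. now replace m with (S p) by lia.
Qed.

Lemma rsum_const_from (f : nat -> R) (u : R) (p q : nat) : (p <= q)%nat ->
  (forall m, (p < m <= q)%nat -> f m = u) ->
  rsum f q = rsum f p + (INR q - INR p) * u.
Proof.
intros Hpq. induction Hpq as [|q Hpq IH]; intros H; [ring | ].
cbn [rsum]. rewrite IH, S_INR, (H (S q)); [ring | lia | intros; apply H; lia].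
Qed.

(* A level on which [G] is constant ends with a drop of at least one, so its trapezoid
   exceeds the sum of [G] by half the length of the level. *)
Lemma area_flat (a r : R) (G : nat -> nat) (q p : nat) : 0 < a -> 0 < r ->
  (forall m n, (m <= n)%nat -> (G n <= G m)%nat) ->
  (forall m, INR m <= r -> INR (G m) <= a * arc r (INR m)) ->
  G q = G O -> (forall m, (q < m)%nat -> (G m < G O)%nat) ->
  (q <= p)%nat -> INR p <= r ->
  rsum (fun m => INR (G m)) p + (INR p - INR q) / 2 + 2 / 3 * (a * r - INR (G O)) * INR q
    <= a * area r (INR p).
Proof.
intros Ha Hr HG Hle Hq Hlt. induction p as [p IH] using lt_wf_ind. intros Hqp Hp.
assert (Hq0 := pos_INR q).
(* The top level has no drop before it; its gain is the cap above height [G O]. *)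
destruct (Nat.eq_dec q p) as [<- | Hne].
- pose proof (area_top_cap r (INR q) Hr ltac:(lra)) as Hc.
  pose proof (Hle q Hp) as Hg. rewrite Hq in Hg.
  rewrite (rsum_const_from _ (INR (G O)) 0); [ | lia | ].
  2: { intros m Hm. f_equal. pose proof (HG m q). pose proof (HG 0%nat m). lia. }
  simpl. assert (a * (INR q * arc r (INR q) + 2 / 3 * INR q * (r - arc r (INR q)))
    <= a * area r (INR q)) by (apply Rmult_le_compat_l; lra).
  assert (INR q * INR (G O) <= INR q * (a * arc r (INR q))) by (apply Rmult_le_compat_l; lra).
  lra.
- destruct (last_higher G p) as [p' [H1 [H2 H3]]]; auto; [apply Hlt; lia | ].
  assert (Hqp' : (q <= p')%nat).
  { destruct (Nat.le_gt_cases q p') as [ | Hc]; [auto | ].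
    specialize (H3 q ltac:(lia)). specialize (Hlt p ltac:(lia)). lia. }
  assert (Hpp : INR p' <= INR p) by (apply le_INR; lia).
  specialize (IH p' H1 Hqp' ltac:(lra)). pose proof (pos_INR p') as Hp0.
  rewrite (rsum_const_from _ (INR (G p)) p'); [ | lia | now intros m Hm; rewrite H3].
  pose proof (area_trapezoid r (INR p') (INR p) Hr ltac:(lra) Hp) as Ht.
  pose proof (Hle p Hp) as Hg. pose proof (Hle p' ltac:(lra)) as Hg'.
  assert (INR (G p) + 1 <= INR (G p')) by (rewrite <- S_INR; apply le_INR; lia).
  assert (a * ((INR p - INR p') * (arc r (INR p') + arc r (INR p)) / 2)
    <= a * (area r (INR p) - area r (INR p'))) by (apply Rmult_le_compat_l; lra).
  assert ((INR p - INR p') * (2 * INR (G p) + 1)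
    <= (INR p - INR p') * (a * arc r (INR p') + a * arc r (INR p)))
    by (apply Rmult_le_compat_l; lra).
  lra.
Qed.

(** * Lattice points and area *)

Definition nfloor (x : R) : nat := Z.to_nat (Int_part x).

Lemma nfloor_spec (x : R) : 0 <= x -> INR (nfloor x) <= x < INR (nfloor x) + 1.
Proof.
intros Hx. destruct (base_Int_part x) as [H1 H2].
assert (H0 : (0 <= Int_part x)%Z).
{ apply Z.lt_succ_r. apply lt_IZR. rewrite succ_IZR. lra. }
unfold nfloor. rewrite INR_IZR_INZ, Z2Nat.id by exact H0. lra.
Qed.

Lemma le_nfloor (n : nat) (x : R) : INR n <= x -> (n <= nfloor x)%nat.
Proof.
intros H. pose proof (pos_INR n) as Hn. destruct (nfloor_spec x) as [_ H2]; [lra | ].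
apply Nat.lt_succ_r. apply INR_lt. rewrite S_INR. lra.
Qed.

Lemma rsum_le_from (f g : nat -> R) (p q : nat) : (p <= q)%nat ->
  (forall m, (p < m <= q)%nat -> f m <= g m) ->
  rsum f q - rsum f p <= rsum g q - rsum g p.
Proof.
intros Hpq. induction Hpq as [|q Hpq IH]; intros H; [lra | ].
cbn [rsum]. pose proof (H (S q) ltac:(lia)).
assert (rsum f q - rsum f p <= rsum g q - rsum g p) by (apply IH; intros; apply H; lia).
lra.
Qed.

(* [1/3 - s + 4 s^3 / 3 = (2 s - 1)^2 (s + 1) / 3] with [s = sqrt e]. *)
Lemma cap_defect (x c e : R) : 0 <= x -> 0 <= c -> 0 <= e -> x ^ 2 <= c * e ->
  x * (1 - 4 / 3 * e) <= sqrt c / 3.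
Proof.
intros Hx Hc He H. pose proof (sqrt_pos c) as Hsc. pose proof (sqrt_pos e) as Hse.
destruct (Rle_or_lt (1 - 4 / 3 * e) 0) as [Hneg | Hpos]; [nra | ].
assert (Hxs : x <= sqrt c * sqrt e).
{ rewrite <- sqrt_mult, <- (sqrt_pow2 x) by lra. now apply sqrt_le_1_alt. }
assert (Hs : sqrt e * (1 - 4 / 3 * e) <= / 3).
{ pose proof (pow2_sqrt e He) as E. set (s := sqrt e) in *. rewrite <- E.
  assert (0 <= (2 * s - 1) ^ 2 * (s + 1))
    by (apply Rmult_le_pos; [apply pow2_ge_0 | lra]). nra. }
apply Rle_trans with (sqrt c * sqrt e * (1 - 4 / 3 * e)).
- apply Rmult_le_compat_r; lra.
- rewrite Rmult_assoc. apply Rmult_le_compat_l; lra.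
Qed.

(** With [e = r - Q], [arc^2 = e (r + Q) <= 2 r e]. The left side is twice the half ordinate left
    over by the trapezoids at [Q], less the area of the side cap. *)
Lemma side_cap_defect (r : R) (Q : nat) : 0 < r -> INR Q <= r ->
  arc r (INR Q) * (1 - 4 / 3 * (r - INR Q)) <= sqrt (2 * r) / 3.
Proof.
intros Hr HQ. pose proof (pos_INR Q) as H0.
apply cap_defect; try lra; [apply arc_ge_0 | rewrite arc_sqr; nra].
Qed.

Lemma below_arc (b r : R) (k : nat) (m : Z) (n : nat) :
  0 < b -> 0 <= r -> PI * r ^ 2 = 2 * INR k * b -> below b k m n ->
  INR (Z.abs_nat m) ^ 2 + INR n ^ 2 * b ^ 2 < r ^ 2.
Proof.
intros Hb Hr E H. unfold below in H. rewrite <- E in H.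
apply Rmult_lt_reg_l in H; [ | apply PI_RGT_0].
replace (INR (Z.abs_nat m) ^ 2) with (IZR m ^ 2); [exact H | ].
rewrite INR_IZR_INZ, Nat2Z.inj_abs_nat, abs_IZR. symmetry. apply pow2_abs.
Qed.

Lemma le_arc (x y r : R) : 0 <= x -> x ^ 2 + y ^ 2 <= r ^ 2 -> x <= arc r y.
Proof.
intros Hx H. unfold arc. rewrite <- (sqrt_pow2 x) by exact Hx. apply sqrt_le_1_alt. lra.
Qed.

(* For [b >= 2] truncating the rows is not needed: the trapezoid rule alone gains [b R]. *)
Lemma few_below_wide (b : R) (k : nat) : 2 <= b -> (1 <= k)%nat -> few_below b k.
Proof.
intros Hb Hk. pose proof PI_RGT_0 as Hpi. apply le_INR in Hk. simpl in Hk.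
(* [R = r / b] is the semi-axis in the direction of [n]. *)
set (R2 := 2 * INR k / (PI * b)).
assert (HR2 : 0 < R2).
{ apply Rmult_lt_0_compat; [lra | ]. apply Rinv_0_lt_compat. nra. }
set (R := sqrt R2). assert (HR : 0 < R) by now apply sqrt_lt_R0.
assert (ER : PI * b * R ^ 2 = 2 * INR k).
{ unfold R. rewrite pow2_sqrt by lra. unfold R2. field. lra. }
apply few_below_rows with (q := fun n => nfloor (b * arc R (INR n))) (M := nfloor R).
- intros m n Hn H. apply (below_arc b (b * R)) in H; [ | lra | nra | nra].
  pose proof (pos_INR n) as H0. split.
  + apply le_nfloor. assert (INR n ^ 2 < R ^ 2); [ | nra].
    apply Rmult_lt_reg_l with (b ^ 2); [nra | ].
    pose proof (pow2_ge_0 (INR (Z.abs_nat m))). nra.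
  + rewrite <- Nat2Z.inj_abs_nat. apply inj_le, le_nfloor.
    apply Rmult_le_reg_l with (/ b); [apply Rinv_0_lt_compat; lra | ].
    rewrite <- Rmult_assoc, Rinv_l, Rmult_1_l by lra. apply le_arc.
    * apply Rmult_le_pos; [left; apply Rinv_0_lt_compat; lra | apply pos_INR].
    * apply Rmult_le_reg_l with (b ^ 2); [nra | ].
      replace (b ^ 2 * ((/ b * INR (Z.abs_nat m)) ^ 2 + INR n ^ 2))
        with (INR (Z.abs_nat m) ^ 2 + INR n ^ 2 * b ^ 2) by (field; lra).
      nra.
- destruct (nfloor_spec R) as [HM _]; [lra | ].
  destruct (nfloor R) as [ | M'] eqn:EM; [simpl; lra | ]. rewrite <- EM in *.
  set (M := nfloor R) in *.
  assert (HR1 : 1 <= INR M) by (rewrite EM, S_INR; pose proof (pos_INR M'); lra).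
  apply Rle_lt_trans with (rsum (fun n => (2 * b) * arc R (INR n) + 1) M).
  { apply rsum_le. intros n _.
    pose proof (arc_ge_0 R (INR n)) as Ha.
    destruct (nfloor_spec (b * arc R (INR n))) as [H _]; [nra | ]. lra. }
  rewrite rsum_affine.
  pose proof (area_steep R 0 M HR ltac:(lia) HM) as H1.
  pose proof (area_side_cap R (INR M) HR ltac:(lra)) as H2.
  pose proof (side_cap_defect R M HR HM) as H3.
  simpl (INR 0) in H1. simpl (rsum _ 0) in H1.
  rewrite area_0, arc_0 in H1 by lra. rewrite area_r in H2 by lra.
  (* [1.45^2 > 2] and [R >= 1]. As [2 (1 - 1.45 / 3) > 1], the gain [b R] less the end defect still
     exceeds the [M <= R] points on the axis. *)
  assert (H4 : sqrt (2 * R) <= 1.45 * R).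
  { rewrite <- (sqrt_pow2 (1.45 * R)) by lra. apply sqrt_le_1_alt. nra. }
  set (S := rsum _ M) in *.
  assert (H5 : 2 * S <= PI * R ^ 2 / 2 - R + 1.45 * R / 3) by lra.
  assert (b * (2 * S) <= b * (PI * R ^ 2 / 2 - R + 1.45 * R / 3))
    by (apply Rmult_le_compat_l; lra).
  nra.
Qed.

(** A downward search from [n] stops at the end of the top level. *)
Lemma last_maximal (G : nat -> nat) (n : nat) :
  (forall m n, (m <= n)%nat -> (G n <= G m)%nat) -> (G n < G O)%nat ->
  exists q, G q = G O /\ forall m, (q < m)%nat -> (G m < G O)%nat.
Proof.
intros HG. induction n as [|n IH]; intros Hn; [lia | ].
pose proof (HG 0%nat n ltac:(lia)).
destruct (Nat.eq_dec (G n) (G O)) as [E | E]; [ | apply IH; lia].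
exists n. split; auto. intros m Hm. pose proof (HG (S n) m). lia.
Qed.

(* The abscissa of slope [-1] of the arc, where [x + a arc r x] reaches its maximum
   [r sqrt (1 + a^2)]. *)
Lemma slope_one (a r : R) (c := sqrt (1 + a ^ 2)) : 1 / 2 <= a <= 1.5708 -> 18 <= r ->
  exists p : nat, r / 1.87 - 1 < INR p <= r /\ r * c - 1 / 2 <= INR p + a * arc r (INR p).
Proof.
intros Ha Hr.
assert (Hc2 : c ^ 2 = 1 + a ^ 2) by (unfold c; apply pow2_sqrt; nra).
assert (Hc0 : 0 <= c) by apply sqrt_pos.
assert (Hc : 1 <= c <= 1.87) by (split; nra).
assert (Hrc : 0 <= r / c) by (apply Rmult_le_pos; [lra | left; apply Rinv_0_lt_compat; lra]).
destruct (nfloor_spec (r / c) Hrc) as [H1 H2]. set (p := nfloor (r / c)) in *.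
exists p. pose proof (pos_INR p) as Hp0. set (x := INR p) in *.
assert (Er : r = r / c * c) by (field; lra).
assert (H3 : 0 <= r - c * x <= c) by (rewrite Er; nra).
assert (Hxr : x <= r) by nra.
split.
{ split; [ | exact Hxr]. assert (r / 1.87 <= r / c); [ | lra].
  apply Rmult_le_compat_l; [lra | ]. apply Rinv_le_contravar; lra. }
(* As [(r c - x)^2 - a^2 (r^2 - x^2) = (r - c x)^2 <= c^2], this is what lets a decrease of
   [r c - x] by 1/2 absorb the error of rounding [r / c] down. *)
assert (H4 : c ^ 2 + 1 / 4 <= r * c - x).
{ apply Rmult_le_reg_l with c; [lra | ].
  assert (r * a ^ 2 <= c * (r * c - x)) by nra.
  assert (c * (c ^ 2 + 1 / 4) <= 1.87 * (1.25 + a ^ 2)) by (rewrite Hc2; nra).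
  assert (18 * a ^ 2 <= r * a ^ 2) by (apply Rmult_le_compat_r; nra).
  nra. }
pose proof (arc_ge_0 r x) as Harc. pose proof (arc_sqr r x ltac:(lra)) as Harc2.
assert (H5 : (r * c - x - 1 / 2) ^ 2 <= (a * arc r x) ^ 2).
{ replace ((a * arc r x) ^ 2) with (a ^ 2 * arc r x ^ 2) by ring. rewrite Harc2.
  replace (a ^ 2) with (c ^ 2 - 1) by lra.
  assert ((r - c * x) ^ 2 <= c ^ 2) by (apply pow_incr; lra). nra. }
assert (H6 : 0 <= a * arc r x) by nra.
destruct (Rle_or_lt (r * c - x - 1 / 2) (a * arc r x)) as [ | Hlt]; [lra | nra].
Qed.

(** The term [a r] pays for the central column, the two roots for the ends of the arc, and 1/2 for
    rounding the abscissa of slope -1. The worst case is [b] near [2 / PI], where [c - a] is least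
    and [sqrt b + a] greatest. *)
Lemma slope_gain (a b r : R) (c := sqrt (1 + a ^ 2)) :
  a * b = 1 -> 226 / 355 <= b <= 2 -> 1 / 2 <= a <= 1.5708 -> 18 <= r ->
  a * r + sqrt (2 * r * b) / 3 + a * (sqrt (2 * r) / 3) < r * c - 1 / 2.
Proof.
intros Eab Hb Ha Hr.
assert (Hc2 : c ^ 2 = 1 + a ^ 2) by (unfold c; apply pow2_sqrt; nra).
assert (Hc0 : 0 <= c) by apply sqrt_pos.
assert (Hc : a + 0.2912 <= c) by nra.
rewrite sqrt_mult by lra.
pose proof (pow2_sqrt (2 * r) ltac:(lra)) as Ez. pose proof (sqrt_pos (2 * r)) as Hz0.
set (z := sqrt (2 * r)) in *.
pose proof (pow2_sqrt b ltac:(lra)) as Ew. pose proof (sqrt_pos b) as Hw0.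
set (w := sqrt b) in *.
assert (Hz : 6 <= z) by nra.
assert (Hw : 0.7978 <= w <= 1.42) by (split; nra).
assert (Hwa : w + a <= 2.37).
{ apply Rmult_le_reg_r with b; [lra | ].
  replace ((w + a) * b) with (w ^ 3 + 1) by (rewrite <- Ew in *; nra).
  rewrite <- Ew. nra. }
(* It remains that [0.79 z + 1 / 2 < 0.1456 z^2]; at [z = 6] this reads [5.24 < 5.2416], so the
   threshold 18 for [r] is nearly optimal here. *)
assert (0.2912 * r <= (c - a) * r) by (apply Rmult_le_compat_r; lra).
assert (z * (w + a) <= z * 2.37) by (apply Rmult_le_compat_l; lra).
nra.
Qed.

Lemma few_below_large (b : R) (k : nat) :
  2 / PI <= b <= 2 -> 324 * PI <= 2 * INR k * b -> few_below b k.
Proof.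
intros Hb Hk. pose proof PI_bounds as Hpi.
assert (Hb' : 226 / 355 <= b).
{ apply Rle_trans with (2 / PI); [ | lra].
  apply Rmult_le_reg_r with PI; [lra | field_simplify; lra]. }
set (a := / b). assert (Eab : a * b = 1) by (unfold a; field; lra).
assert (Ha : 1 / 2 <= a <= 1.5708) by (split; nra).
set (r := sqrt (2 * INR k * b / PI)).
assert (Hrad : 324 <= 2 * INR k * b / PI)
  by (apply Rmult_le_reg_r with PI; [lra | field_simplify; lra]).
assert (Er : PI * r ^ 2 = 2 * INR k * b)
  by (unfold r; rewrite pow2_sqrt by lra; field; lra).
assert (Hr : 18 <= r).
{ unfold r. rewrite <- (sqrt_pow2 18) by lra. apply sqrt_le_1_alt. lra. }
set (G := fun m : nat => nfloor (a * arc r (INR m))).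
assert (Hg : forall m, INR (G m) <= a * arc r (INR m) < INR (G m) + 1).
{ intros m. apply nfloor_spec. pose proof (arc_ge_0 r (INR m)). nra. }
assert (HG : forall m n, (m <= n)%nat -> (G n <= G m)%nat).
{ intros m n Hmn. apply le_nfloor. apply Rle_trans with (a * arc r (INR n)); [apply Hg | ].
  apply Rmult_le_compat_l; [lra | ]. apply arc_decr.
  split; [apply pos_INR | now apply le_INR]. }
destruct (nfloor_spec r) as [HQ HQ']; [lra | ]. set (Q := nfloor r) in *.
pose proof (Hg 0%nat) as HV. change (INR 0) with 0 in HV. rewrite arc_0 in HV by lra.
destruct (last_maximal G (S Q)) as [q [Hq1 Hq2]]; auto.
(* [sqrt] is 0 on negative numbers, so [G] vanishes beyond [r]. *)
{ apply INR_lt. assert (a * arc r (INR (S Q)) = 0).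
  { unfold arc. rewrite sqrt_neg_0; [ring | rewrite S_INR; nra]. }
  pose proof (Hg (S Q)). nra. }
pose proof (Hg q) as Hgq. rewrite Hq1 in Hgq. pose proof (pos_INR q) as Hq0.
set (V := INR (G O)) in *.
assert (HVpos : 1 <= V) by nra.
assert (Hqr : INR q <= r).
{ destruct (Rle_or_lt (INR q) r) as [ | Hc]; [auto | exfalso].
  assert (arc r (INR q) = 0) by (unfold arc; apply sqrt_neg_0; nra). nra. }
(* The half width of the top level against its depth [a r - V < 1], in the form required by
   [cap_defect]. *)
assert (Hqsqr : INR q ^ 2 <= 2 * r * b * (a * r - V)).
{ pose proof (arc_sqr r (INR q) ltac:(lra)) as E.
  assert (V ^ 2 <= a ^ 2 * (r ^ 2 - INR q ^ 2)).
  { rewrite <- E, <- Rpow_mult_distr. apply pow_incr. lra. }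
  assert (a ^ 2 * INR q ^ 2 <= 2 * a * r * (a * r - V)) by nra.
  apply Rmult_le_reg_l with (a ^ 2); [nra | ].
  replace (a ^ 2 * (2 * r * b * (a * r - V)))
    with ((a * b) * (2 * a * r * (a * r - V))) by ring.
  rewrite Eab. lra. }
destruct (slope_one a r Ha Hr) as [p [[Hp1 Hp2] Hp3]].
(* [q^2 <= 4 r] by the previous bound, and [4 r <= (r / 1.87 - 1)^2] once [r >= 18]. *)
assert (Hqp : (q <= p)%nat).
{ apply INR_le. assert (INR q ^ 2 <= (r / 1.87 - 1) ^ 2); [ | nra].
  apply Rle_trans with (4 * r); [ | nra].
  apply Rle_trans with (2 * r * b * (a * r - V)); [auto | ].
  apply Rle_trans with (2 * r * 2 * 1); [ | lra].
  apply Rmult_le_compat; nra. }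
assert (HpQ : (p <= Q)%nat) by now apply le_nfloor.
apply few_below_columns with (G := G) (Q := Q).
- intros m n Hn H. apply (below_arc b r) in H; [ | lra | lra | auto].
  pose proof (pos_INR n) as Hn0. pose proof (pos_INR (Z.abs_nat m)) as Hm0. split.
  + apply le_nfloor. nra.
  + apply le_nfloor. apply Rmult_le_reg_l with b; [lra | ].
    replace (b * (a * arc r (INR (Z.abs_nat m))))
      with ((a * b) * arc r (INR (Z.abs_nat m))) by ring.
    rewrite Eab, Rmult_1_l. apply le_arc; nra.
- pose proof (area_flat a r G q p ltac:(lra) ltac:(lra) HG (fun m _ => proj1 (Hg m))
    Hq1 Hq2 Hqp Hp2) as H1.
  pose proof (area_steep r p Q ltac:(lra) HpQ HQ) as H2.
  pose proof (area_side_cap r (INR Q) ltac:(lra) (conj (pos_INR Q) HQ)) as H3.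
  rewrite area_r in H3 by lra.
  pose proof (side_cap_defect r Q ltac:(lra) HQ) as H4.
  pose proof (cap_defect (INR q) (2 * r * b) (a * r - V) Hq0 ltac:(nra) ltac:(lra) Hqsqr)
    as H5.
  pose proof (slope_gain a b r Eab ltac:(lra) Ha Hr) as H6.
  fold V in H1 |- *.
  assert (H7 : rsum (fun m => INR (G m)) Q - rsum (fun m => INR (G m)) p
    <= a * (rsum (fun m => arc r (INR m)) Q - rsum (fun m => arc r (INR m)) p)).
  { pose proof (rsum_le_from (fun m => INR (G m)) (fun m => a * arc r (INR m) + 0) p Q HpQ)
      as H. rewrite !rsum_affine in H.
    assert (forall m, (p < m <= Q)%nat -> INR (G m) <= a * arc r (INR m) + 0)
      by (intros m _; pose proof (Hg m); lra).
    specialize (H ltac:(assumption)). lra. }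
  (* Doubled, the area bounds give [k - (p + a arc r p)] plus the two end defects for the columns
     other than 0; by [H3] to [H6] and [Hp3] this is less than [k - a r], and [V <= a r]. *)
  assert (H8 : a * (PI * r ^ 2 / 4) = INR k / 2) by (rewrite Er; nra).
  apply (Rmult_le_compat_l a) in H2, H3, H4; [ | lra ..].
  lra.
Qed.

(** * The remaining values of k *)

Lemma few_below_boxes (k1 k2 i j : Z) (b : R) (k : nat) :
  boxes 40 k1 k2 i j = true -> (0 < i)%Z -> (0 <= k1)%Z ->
  IZR i / 1000 <= b <= IZR j / 1000 -> (k1 <= Z.of_nat k <= k2)%Z ->
  2 / PI <= b <= 2 -> few_below b k.
Proof.
intros H Hi H1 Hb Hk Hb2. destruct (Rlt_or_le (2 * INR k * b) (324 * PI)).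
- now apply (boxes_few_below 40 k1 k2 i j).
- now apply few_below_large.
Qed.

Lemma two_div_PI : 226 / 355 < 2 / PI.
Proof.
pose proof PI_bounds. apply Rmult_lt_reg_r with PI; [lra | field_simplify; lra].
Qed.

(** [g] lists the heights of columns 0, 1, 2 and so on; the default 0 of [nth] makes all later
    columns empty, including the last index of the sum. *)
Lemma few_below_list (b : R) (k : nat) (g : list nat) :
  (forall x n : nat, (1 <= n)%nat ->
     PI * (INR x ^ 2 + INR n ^ 2 * b ^ 2) < 2 * INR k * b -> (n <= nth x g 0)%nat) ->
  INR (nth 0 g 0)%nat + 2 * rsum (fun m => INR (nth m g 0%nat)) (length g) < INR k ->
  few_below b k.
Proof.
intros H. apply few_below_columns with (G := fun m => nth m g 0%nat). intros m n Hn Hb.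
assert (Hle : (n <= nth (Z.abs_nat m) g 0)%nat).
{ apply H; auto. rewrite INR_IZR_INZ, Nat2Z.inj_abs_nat, abs_IZR, pow2_abs. exact Hb. }
split; [ | exact Hle].
destruct (Nat.le_gt_cases (Z.abs_nat m) (length g)) as [ | Hc]; [auto | ].
rewrite nth_overflow in Hle; lia.
Qed.

(** The form increases in both coordinates, so one excluded corner removes the whole quadrant beyond
    it. *)
Lemma excluded_corner (b T : R) (x' n' x n : nat) :
  T <= PI * (INR x' ^ 2 + INR n' ^ 2 * b ^ 2) ->
  PI * (INR x ^ 2 + INR n ^ 2 * b ^ 2) < T -> (x < x' \/ n < n')%nat.
Proof.
intros H1 H2. destruct (Nat.le_gt_cases x' x) as [Hx | ]; [ | now left].
destruct (Nat.le_gt_cases n' n) as [Hn | ]; [ | now right]. exfalso.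
apply (Rlt_not_le _ _ H2). apply Rle_trans with (1 := H1).
apply Rmult_le_compat_l; [left; apply PI_RGT_0 | ].
apply Rplus_le_compat; [ | apply Rmult_le_compat_r; [apply pow2_ge_0 | ]];
  apply pow_incr; (split; [apply pos_INR | now apply le_INR]).
Qed.

Lemma two_le_PI_mult (b : R) : 2 / PI <= b -> 2 <= PI * b.
Proof.
intros Hb. pose proof PI_RGT_0. apply (Rmult_le_compat_l PI) in Hb; [ | lra].
now replace (PI * (2 / PI)) with 2 in Hb by (field; lra).
Qed.

(** The lowest mode [(0, 1)] is excluded exactly when [2 / PI <= b]. *)
Lemma few_below_1 (b : R) : 2 / PI <= b -> few_below b 1.
Proof.
intros Hb. pose proof two_div_PI as H0. pose proof (two_le_PI_mult b Hb) as H1.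
apply few_below_list with (g := nil); [ | simpl; lra].
intros x n Hn H. exfalso.
assert (E01 : 2 * INR 1 * b <= PI * (INR 0 ^ 2 + INR 1 ^ 2 * b ^ 2)) by (simpl; nra).
pose proof (excluded_corner _ _ _ _ _ _ E01 H). lia.
Qed.

(* At [b = 2 / PI] the eigenvalue of the mode [(0, 2)] is exactly [2 k / h]. *)
Lemma few_below_4 (b : R) : 2 / PI <= b <= 65 / 100 -> few_below b 4.
Proof.
intros Hb. pose proof two_div_PI as H0. pose proof PI_bounds as Hpi.
pose proof (two_le_PI_mult b ltac:(lra)) as H1.
apply few_below_list with (g := (1 :: 1 :: nil)%nat); [ | simpl; lra].
assert (E02 : 2 * INR 4 * b <= PI * (INR 0 ^ 2 + INR 2 ^ 2 * b ^ 2)) by (simpl; nra).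
assert (E20 : 2 * INR 4 * b <= PI * (INR 2 ^ 2 + INR 0 ^ 2 * b ^ 2)) by (simpl; lra).
intros x n Hn H.
pose proof (excluded_corner _ _ _ _ _ _ E02 H).
pose proof (excluded_corner _ _ _ _ _ _ E20 H).
destruct x as [ | [ | x]]; simpl; lia.
Qed.

(** Excluding either corner, [(2, 1)] or [(1, 2)], leaves at most 6 modes. *)
Lemma few_below_8 (b : R) : 96 / 100 <= b <= 104 / 100 ->
  16 * b <= PI * (4 + b ^ 2) \/ 16 * b <= PI * (1 + 4 * b ^ 2) -> few_below b 8.
Proof.
intros Hb Hor. pose proof PI_bounds as Hpi.
assert (Hb2 : 92 / 100 <= b ^ 2) by nra.
assert (Hpb : 333 / 106 * (92 / 100) <= PI * b ^ 2) by (apply Rmult_le_compat; lra).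
assert (E03 : 2 * INR 8 * b <= PI * (INR 0 ^ 2 + INR 3 ^ 2 * b ^ 2)) by (simpl; lra).
assert (E30 : 2 * INR 8 * b <= PI * (INR 3 ^ 2 + INR 0 ^ 2 * b ^ 2)) by (simpl; lra).
destruct Hor as [Hor | Hor].
- apply few_below_list with (g := (2 :: 2 :: nil)%nat); [ | simpl; lra].
  assert (E21 : 2 * INR 8 * b <= PI * (INR 2 ^ 2 + INR 1 ^ 2 * b ^ 2)) by (simpl; lra).
  intros x n Hn H.
  pose proof (excluded_corner _ _ _ _ _ _ E03 H).
  pose proof (excluded_corner _ _ _ _ _ _ E21 H).
  destruct x as [ | [ | x]]; simpl; lia.
- apply few_below_list with (g := (2 :: 1 :: 1 :: nil)%nat); [ | simpl; lra].
  assert (E12 : 2 * INR 8 * b <= PI * (INR 1 ^ 2 + INR 2 ^ 2 * b ^ 2)) by (simpl; lra).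
  intros x n Hn H.
  pose proof (excluded_corner _ _ _ _ _ _ E03 H).
  pose proof (excluded_corner _ _ _ _ _ _ E12 H).
  pose proof (excluded_corner _ _ _ _ _ _ E30 H).
  destruct x as [ | [ | [ | x]]]; simpl; lia.
Qed.

(** Excluding either corner, [(2, 2)] or [(1, 3)], leaves at most 11 modes. *)
Lemma few_below_13 (b : R) : 765 / 1000 <= b <= 780 / 1000 ->
  26 * b <= PI * (4 + 4 * b ^ 2) \/ 26 * b <= PI * (1 + 9 * b ^ 2) -> few_below b 13.
Proof.
intros Hb Hor. pose proof PI_bounds as Hpi.
assert (Hb2 : 58 / 100 <= b ^ 2) by nra.
assert (Hpb : 333 / 106 * (58 / 100) <= PI * b ^ 2) by (apply Rmult_le_compat; lra).
assert (E04 : 2 * INR 13 * b <= PI * (INR 0 ^ 2 + INR 4 ^ 2 * b ^ 2)) by (simpl; lra).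
assert (E30 : 2 * INR 13 * b <= PI * (INR 3 ^ 2 + INR 0 ^ 2 * b ^ 2)) by (simpl; lra).
assert (E23 : 2 * INR 13 * b <= PI * (INR 2 ^ 2 + INR 3 ^ 2 * b ^ 2)) by (simpl; lra).
destruct Hor as [Hor | Hor].
- apply few_below_list with (g := (3 :: 3 :: 1 :: nil)%nat); [ | simpl; lra].
  assert (E22 : 2 * INR 13 * b <= PI * (INR 2 ^ 2 + INR 2 ^ 2 * b ^ 2)) by (simpl; lra).
  intros x n Hn H.
  pose proof (excluded_corner _ _ _ _ _ _ E04 H).
  pose proof (excluded_corner _ _ _ _ _ _ E30 H).
  pose proof (excluded_corner _ _ _ _ _ _ E22 H).
  destruct x as [ | [ | [ | x]]]; simpl; lia.
- apply few_below_list with (g := (3 :: 2 :: 2 :: nil)%nat); [ | simpl; lra].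
  assert (E13 : 2 * INR 13 * b <= PI * (INR 1 ^ 2 + INR 3 ^ 2 * b ^ 2)) by (simpl; lra).
  intros x n Hn H.
  pose proof (excluded_corner _ _ _ _ _ _ E04 H).
  pose proof (excluded_corner _ _ _ _ _ _ E13 H).
  pose proof (excluded_corner _ _ _ _ _ _ E30 H).
  destruct x as [ | [ | [ | x]]]; simpl; lia.
Qed.

Lemma few_below_nonsharp (b : R) (k : nat) : 2 / PI <= b -> (1 <= k)%nat ->
  (k = 8%nat -> 16 * b <= PI * (4 + b ^ 2) \/ 16 * b <= PI * (1 + 4 * b ^ 2)) ->
  (k = 13%nat -> 26 * b <= PI * (4 + 4 * b ^ 2) \/ 26 * b <= PI * (1 + 9 * b ^ 2)) ->
  few_below b k.
Proof.
(* The left end [636 / 1000] of the boxes lies just under [226 / 355 < 2 / PI]. *)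
intros Hb Hk H8 H13. pose proof two_div_PI as H0.
destruct (Rle_or_lt 2 b) as [Hb2 | Hb2]; [now apply few_below_wide | ].
destruct (Nat.eq_dec k 1) as [-> | ]; [now apply few_below_1 | ].
destruct (Nat.eq_dec k 4) as [-> | ].
{ destruct (Rle_or_lt b (65 / 100)); [now apply few_below_4 | ].
  apply (few_below_boxes 4 4 650 2000);
    [vm_compute; reflexivity | lia || lra ..]. }
destruct (Nat.eq_dec k 8) as [-> | ].
{ destruct (Rle_or_lt b (96 / 100)).
  { apply (few_below_boxes 8 8 636 960);
    [vm_compute; reflexivity | lia || lra ..]. }
  destruct (Rle_or_lt b (104 / 100)).
  { apply few_below_8; [lra | auto]. }
  apply (few_below_boxes 8 8 1040 2000);
    [vm_compute; reflexivity | lia || lra ..]. }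
destruct (Nat.eq_dec k 13) as [-> | ].
{ destruct (Rle_or_lt b (765 / 1000)).
  { apply (few_below_boxes 13 13 636 765);
    [vm_compute; reflexivity | lia || lra ..]. }
  destruct (Rle_or_lt b (780 / 1000)).
  { apply few_below_13; [lra | auto]. }
  apply (few_below_boxes 13 13 780 2000);
    [vm_compute; reflexivity | lia || lra ..]. }
destruct (Nat.le_gt_cases k 3).
{ apply (few_below_boxes 2 3 636 2000);
    [vm_compute; reflexivity | lia || lra ..]. }
destruct (Nat.le_gt_cases k 7).
{ apply (few_below_boxes 5 7 636 2000);
    [vm_compute; reflexivity | lia || lra ..]. }
destruct (Nat.le_gt_cases k 12).
{ apply (few_below_boxes 9 12 636 2000);
    [vm_compute; reflexivity | lia || lra ..]. }
destruct (Nat.le_gt_cases k 800) as [ | Hc].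
{ apply (few_below_boxes 14 800 636 2000);
    [vm_compute; reflexivity | lia || lra ..]. }
(* From [k = 801] on, [r >= 18] for every admissible [b]. *)
apply few_below_large; [lra | ].
apply le_INR in Hc. rewrite INR_IZR_INZ in Hc. simpl in Hc. pose proof PI_bounds.
assert (801 * (226 / 355) <= INR k * b) by (apply Rmult_le_compat; lra). lra.
Qed.

(** * Violations by explicit modes *)

(** The hypotheses put the corners [(2, 1)] and [(1, 2)] below the bound; they dominate the other
    listed modes. *)
Lemma violation_8 (h : R) (lam : nat -> R) (b := PI / h) : 0 < h ->
  dirichlet_spectrum h lam ->
  PI * (4 + b ^ 2) < 16 * b -> PI * (1 + 4 * b ^ 2) < 16 * b ->
  ~ polya_inequality h lam 8.
Proof.
intros Hh Hs HA HB. pose proof PI_RGT_0 as Hpi.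
assert (Hb2 := pow2_ge_0 b).
assert (Hp : 0 <= PI * b ^ 2) by nra.
apply (spectrum_violation h lam
  ((0, 1%nat) :: (1, 1%nat) :: (-1, 1%nat) :: (2, 1%nat) :: (-2, 1%nat) ::
   (0, 2%nat) :: (1, 2%nat) :: (-1, 2%nat) :: nil)%Z); auto; [discriminate | | ].
- repeat constructor; simpl; intuition discriminate.
- intros p Hin. simpl length. rewrite eigenvalue_below by exact Hh. fold b. unfold below.
  simpl in Hin.
  repeat (destruct Hin as [<- | Hin]; [simpl; split; [lia | lra] | ]). easy.
Qed.

(** Column heights 3, 3, 2 give [3 + 2 (3 + 2) = 13] modes, dominated by the corners [(2, 2)] and
    [(1, 3)]. *)
Lemma violation_13 (h : R) (lam : nat -> R) (b := PI / h) : 0 < h ->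
  dirichlet_spectrum h lam ->
  PI * (4 + 4 * b ^ 2) < 26 * b -> PI * (1 + 9 * b ^ 2) < 26 * b ->
  ~ polya_inequality h lam 13.
Proof.
intros Hh Hs HA HB. pose proof PI_RGT_0 as Hpi.
assert (Hb2 := pow2_ge_0 b).
assert (Hp : 0 <= PI * b ^ 2) by nra.
apply (spectrum_violation h lam
  ((0, 1%nat) :: (1, 1%nat) :: (-1, 1%nat) :: (2, 1%nat) :: (-2, 1%nat) ::
   (0, 2%nat) :: (1, 2%nat) :: (-1, 2%nat) :: (2, 2%nat) :: (-2, 2%nat) ::
   (0, 3%nat) :: (1, 3%nat) :: (-1, 3%nat) :: nil)%Z); auto; [discriminate | | ].
- repeat constructor; simpl; intuition discriminate.
- intros p Hin. simpl length. rewrite eigenvalue_below by exact Hh. fold b. unfold below.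
  simpl in Hin.
  repeat (destruct Hin as [<- | Hin]; [simpl; split; [lia | lra] | ]). easy.
Qed.

(** On a long cylinder the modes [(0, 1)] to [(0, k)] suffice: [PI k^2 b^2 < 2 k b]. *)
Lemma violation_rows (h : R) (lam : nat -> R) (k : nat) (b := PI / h) : 0 < h ->
  (1 <= k)%nat -> dirichlet_spectrum h lam -> PI * INR k * b < 2 ->
  ~ polya_inequality h lam k.
Proof.
intros Hh Hk Hs H. pose proof PI_RGT_0 as Hpi.
assert (Hb : 0 < b) by (apply Rmult_lt_0_compat; [lra | now apply Rinv_0_lt_compat]).
set (L := map (pair 0%Z) (seq 1 k)).
assert (EL : length L = k) by (unfold L; now rewrite length_map, length_seq).
rewrite <- EL. apply spectrum_violation; auto.
- intros E. rewrite E in EL. simpl in EL. lia.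
- apply NoDup_map_NoDup_ForallPairs; [ | apply seq_NoDup]. intros i j _ _ Hij. congruence.
- intros p Hp. apply in_map_iff in Hp. destruct Hp as [n [<- Hn]]. apply in_seq in Hn.
  split; [simpl; lia | ]. rewrite EL, eigenvalue_below by exact Hh. fold b. unfold below.
  simpl fst. simpl snd.
  assert (INR n ^ 2 <= INR k ^ 2)
    by (apply pow_incr; split; [apply pos_INR | apply le_INR; lia]).
  assert (1 <= INR k) by (apply le_INR in Hk; exact Hk).
  apply Rle_lt_trans with (INR k * b * (PI * INR k * b)).
  + replace (INR k * b * (PI * INR k * b)) with (PI * b ^ 2 * INR k ^ 2) by ring.
    replace (PI * (0 ^ 2 + INR n ^ 2 * b ^ 2)) with (PI * b ^ 2 * INR n ^ 2) by ring.
    apply Rmult_le_compat_l; [nra | lra].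
  + replace (2 * INR k * b) with (INR k * b * 2) by ring.
    apply Rmult_lt_compat_l; [nra | lra].
Qed.

(** Clearing [PI / h^2] turns a corner condition into a quadratic inequality in [h]; the roots give
    the end points of the exceptional intervals. *)
Lemma quadratic_in_height (h u v w : R) : 0 < h ->
  PI * (u + v * (PI / h) ^ 2) < w * (PI / h) <-> u * h ^ 2 + v * PI ^ 2 < w * h.
Proof.
intros Hh. pose proof PI_RGT_0 as Hpi.
replace (PI * (u + v * (PI / h) ^ 2)) with (PI / h ^ 2 * (u * h ^ 2 + v * PI ^ 2))
  by (field; lra).
replace (w * (PI / h)) with (PI / h ^ 2 * (w * h)) by (field; lra).
assert (Hpos : 0 < PI / h ^ 2)
  by (apply Rmult_lt_0_compat; [lra | apply Rinv_0_lt_compat; nra]).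
split; intros H; [now apply Rmult_lt_reg_l in H | now apply Rmult_lt_compat_l].
Qed.

Lemma sqrt_between (x u v : R) : 0 <= u -> 0 <= v -> u ^ 2 <= x <= v ^ 2 -> u <= sqrt x <= v.
Proof.
intros Hu Hv [H1 H2].
rewrite <- (sqrt_pow2 u), <- (sqrt_pow2 v) by assumption.
split; now apply sqrt_le_1_alt.
Qed.

Lemma polya_inequality_holds (h : R) (lam : nat -> R) (k : nat) :
  0 < h <= PI ^ 2 / 2 -> dirichlet_spectrum h lam -> (1 <= k)%nat ->
  (k = 8%nat -> 16 * h <= 4 * h ^ 2 + 1 * PI ^ 2 \/ 16 * h <= 1 * h ^ 2 + 4 * PI ^ 2) ->
  (k = 13%nat -> 26 * h <= 4 * h ^ 2 + 4 * PI ^ 2 \/ 26 * h <= 1 * h ^ 2 + 9 * PI ^ 2) ->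
  polya_inequality h lam k.
Proof.
intros Hh Hs Hk H8 H13. pose proof PI_RGT_0 as Hpi.
assert (Hform : forall u v w, w * h <= u * h ^ 2 + v * PI ^ 2 ->
  w * (PI / h) <= PI * (u + v * (PI / h) ^ 2)).
{ intros u v w H. apply Rnot_lt_le. intros Hc.
  apply quadratic_in_height in Hc; lra. }
apply few_below_polya; [lra | auto | ]. apply few_below_nonsharp; auto.
- apply Rmult_le_reg_r with (PI * h); [nra | ]. field_simplify; lra.
- intros E. destruct (H8 E) as [H | H]; apply Hform in H; [left | right]; lra.
- intros E. destruct (H13 E) as [H | H]; apply Hform in H; [left | right]; lra.
Qed.

(** * The exceptional heights *)

(** Failure means that both quadratics are negative. Their roots are [2 +- sqrt (4 - PI^2 / 4)] and
    [8 +- sqrt (64 - 4 PI^2)], and the decimal bounds tell which two delimit the intersection. *)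
Lemma failure_8 (h : R) (lam : nat -> R) : 0 < h <= PI ^ 2 / 2 ->
  dirichlet_spectrum h lam ->
  ~ polya_inequality h lam 8 <->
  8 - sqrt (64 - 4 * PI ^ 2) < h < 2 + sqrt (4 - PI ^ 2 / 4).
Proof.
intros Hh Hs. pose proof PI_bounds as Hpi.
assert (Hpi2 : 9.86 < PI ^ 2 < 9.87) by nra.
assert (H1 := pow2_sqrt (64 - 4 * PI ^ 2) ltac:(lra)).
assert (H2 := pow2_sqrt (4 - PI ^ 2 / 4) ltac:(lra)).
pose proof (sqrt_between (64 - 4 * PI ^ 2) 4.9 5 ltac:(lra) ltac:(lra) ltac:(lra)) as B1.
pose proof (sqrt_between (4 - PI ^ 2 / 4) 1.2 1.3 ltac:(lra) ltac:(lra) ltac:(lra)) as B2.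
set (s1 := sqrt (64 - 4 * PI ^ 2)) in *. set (s2 := sqrt (4 - PI ^ 2 / 4)) in *.
split.
- intros Hpol. split; apply Rnot_le_lt; intros Hc; apply Hpol;
    (apply polya_inequality_holds; auto; [lia | | discriminate]); intros _;
    [right | left]; nra.
- intros Hint. apply violation_8; auto; try lra.
  + replace (PI * (4 + (PI / h) ^ 2)) with (PI * (4 + 1 * (PI / h) ^ 2)) by ring.
    apply quadratic_in_height; nra.
  + apply quadratic_in_height; nra.
Qed.

Lemma failure_13 (h : R) (lam : nat -> R) : 0 < h <= PI ^ 2 / 2 ->
  dirichlet_spectrum h lam ->
  ~ polya_inequality h lam 13 <->
  13 - sqrt (169 - 9 * PI ^ 2) < h < 13 / 4 + sqrt (169 / 16 - PI ^ 2).
Proof.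
intros Hh Hs. pose proof PI_bounds as Hpi.
assert (Hpi2 : 9.869 < PI ^ 2 < 9.87) by nra.
assert (H1 := pow2_sqrt (169 - 9 * PI ^ 2) ltac:(lra)).
assert (H2 := pow2_sqrt (169 / 16 - PI ^ 2) ltac:(lra)).
pose proof (sqrt_between (169 - 9 * PI ^ 2) 8.9 9 ltac:(lra) ltac:(lra) ltac:(lra)) as B1.
pose proof (sqrt_between (169 / 16 - PI ^ 2) 0.8 0.9 ltac:(lra) ltac:(lra) ltac:(lra)) as B2.
set (s1 := sqrt (169 - 9 * PI ^ 2)) in *. set (s2 := sqrt (169 / 16 - PI ^ 2)) in *.
split.
- intros Hpol. split; apply Rnot_le_lt; intros Hc; apply Hpol;
    (apply polya_inequality_holds; auto; [lia | discriminate | ]); intros _;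
    [right | left]; nra.
- intros Hint. apply violation_13; auto; try lra; apply quadratic_in_height; nra.
Qed.

Theorem theorem1 (lambda : R -> nat -> R)
  (Hlambda : forall h : R, 0 < h -> dirichlet_spectrum h (lambda h)) :
  (forall h : R, 0 < h ->
     ((forall k : nat, (1 <= k)%nat -> polya_inequality h (lambda h) k) <->
      (0 < h <= 8 - sqrt (64 - 4 * PI ^ 2) \/
       2 + sqrt (4 - PI ^ 2 / 4) <= h <= 13 - sqrt (169 - 9 * PI ^ 2) \/
       13 / 4 + sqrt (169 / 16 - PI ^ 2) <= h <= PI ^ 2 / 2))) /\
  (forall h : R,
     8 - sqrt (64 - 4 * PI ^ 2) < h < 2 + sqrt (4 - PI ^ 2 / 4) ->
     forall k : nat, (1 <= k)%nat ->
       (~ polya_inequality h (lambda h) k <-> k = 8%nat)) /\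
  (forall h : R,
     13 - sqrt (169 - 9 * PI ^ 2) < h < 13 / 4 + sqrt (169 / 16 - PI ^ 2) ->
     forall k : nat, (1 <= k)%nat ->
       (~ polya_inequality h (lambda h) k <-> k = 13%nat)) /\
  (forall h : R, PI ^ 2 / 2 < h -> ~ polya_inequality h (lambda h) 1) /\
  (exists h : R, PI ^ 2 / 2 < h /\
     exists k : nat, (2 <= k)%nat /\ ~ polya_inequality h (lambda h) k).
Proof.
pose proof PI_bounds as Hpi.
assert (Hpi2 : 9.869 < PI ^ 2 < 9.87) by nra.
(* These bounds place the first gap inside [(3, 3.3)] and the second inside [(4, 4.15)], both below
   [PI^2 / 2 > 4.93]. *)
pose proof (sqrt_between (64 - 4 * PI ^ 2) 4.9 5 ltac:(lra) ltac:(lra) ltac:(lra)) as B1.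
pose proof (sqrt_between (4 - PI ^ 2 / 4) 1.2 1.3 ltac:(lra) ltac:(lra) ltac:(lra)) as B2.
pose proof (sqrt_between (169 - 9 * PI ^ 2) 8.9 9 ltac:(lra) ltac:(lra) ltac:(lra)) as B3.
pose proof (sqrt_between (169 / 16 - PI ^ 2) 0.8 0.9 ltac:(lra) ltac:(lra) ltac:(lra)) as B4.
assert (F8 : forall h, 0 < h <= PI ^ 2 / 2 -> ~ polya_inequality h (lambda h) 8 <->
  8 - sqrt (64 - 4 * PI ^ 2) < h < 2 + sqrt (4 - PI ^ 2 / 4))
  by (intros h Hh; apply failure_8; [exact Hh | apply Hlambda; lra]).
assert (F13 : forall h, 0 < h <= PI ^ 2 / 2 -> ~ polya_inequality h (lambda h) 13 <->
  13 - sqrt (169 - 9 * PI ^ 2) < h < 13 / 4 + sqrt (169 / 16 - PI ^ 2))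
  by (intros h Hh; apply failure_13; [exact Hh | apply Hlambda; lra]).
assert (Hother : forall h k, 0 < h <= PI ^ 2 / 2 -> (1 <= k)%nat -> k <> 8%nat ->
  k <> 13%nat -> polya_inequality h (lambda h) k).
{ intros h k Hh Hk H8 H13. apply polya_inequality_holds; auto; [apply Hlambda; lra | | ];
  intros E; now exfalso. }
assert (Hdec : forall h k, polya_inequality h (lambda h) k \/ ~ polya_inequality h (lambda h) k).
{ intros h k. unfold polya_inequality.
  destruct (Rge_dec (lambda h k) (2 * INR k / h)); [now left | now right]. }
assert (H1 : forall h : R, PI ^ 2 / 2 < h -> ~ polya_inequality h (lambda h) 1).
{ intros h Hh. assert (0 < h) by lra. apply violation_rows; auto.
  apply Rmult_lt_reg_r with h; [lra | ]. simpl (INR 1). field_simplify; lra. }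
set (s1 := sqrt (64 - 4 * PI ^ 2)) in *. set (s2 := sqrt (4 - PI ^ 2 / 4)) in *.
set (s3 := sqrt (169 - 9 * PI ^ 2)) in *. set (s4 := sqrt (169 / 16 - PI ^ 2)) in *.
split; [ | split; [ | split; [ | split; [exact H1 | ]]]].
- intros h Hh. split.
  + intros Hall. assert (Hle : h <= PI ^ 2 / 2).
    { apply Rnot_lt_le. intros Hc. apply (H1 h Hc). now apply Hall. }
    assert (N8 : ~ (8 - s1 < h < 2 + s2)).
    { intros Hc. apply (F8 h (conj Hh Hle)) in Hc. apply Hc, Hall. lia. }
    assert (N13 : ~ (13 - s3 < h < 13 / 4 + s4)).
    { intros Hc. apply (F13 h (conj Hh Hle)) in Hc. apply Hc, Hall. lia. }
    destruct (Rle_or_lt h (8 - s1)); [left; lra | right].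
    destruct (Rle_or_lt h (13 - s3)); [left | right]; split; try lra;
      apply Rnot_lt_le; intros Hc; tauto.
  + intros Hor k Hk. assert (Hh2 : 0 < h <= PI ^ 2 / 2) by lra.
    destruct (Nat.eq_dec k 8) as [-> | ].
    { destruct (Hdec h 8%nat) as [ | Hn]; [auto | apply (F8 h Hh2) in Hn; lra]. }
    destruct (Nat.eq_dec k 13) as [-> | ].
    { destruct (Hdec h 13%nat) as [ | Hn]; [auto | apply (F13 h Hh2) in Hn; lra]. }
    now apply Hother.
- intros h Hh k Hk. assert (Hh2 : 0 < h <= PI ^ 2 / 2) by lra. split.
  + intros Hn. destruct (Nat.eq_dec k 8) as [ | H8]; [auto | exfalso].
    destruct (Nat.eq_dec k 13) as [-> | H13]; [apply (F13 h Hh2) in Hn; lra | ].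
    now apply Hn, Hother.
  + intros ->. now apply F8.
- intros h Hh k Hk. assert (Hh2 : 0 < h <= PI ^ 2 / 2) by lra. split.
  + intros Hn. destruct (Nat.eq_dec k 13) as [ | H13]; [auto | exfalso].
    destruct (Nat.eq_dec k 8) as [-> | H8]; [apply (F8 h Hh2) in Hn; lra | ].
    now apply Hn, Hother.
  + intros ->. now apply F13.
(* Here [PI k b = 1 < 2] for [k = 2]. *)
- exists (2 * PI ^ 2). split; [lra | ]. exists 2%nat. split; [lia | ].
  apply violation_rows; [lra | lia | apply Hlambda; lra | ].
  simpl (INR 2). field_simplify; lra.
Qed.
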